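(* Let $1\le m\le M$ and let $w\in\mathbb{P}^{r_m}(I_m;\mathbb{X}_m)$ have the spectral representation $w(t)=\sum_{i=1}^{n_m}a_i(t)\varphi_i$ with $a_i\in\mathbb{P}^{r_m}(I_m)$. Then $$(\Gamma_m^{r_m})^{-1}(w)=\sum_{i=1}^{n_m}(\Gamma_{\lambda_i,m}^{r_m})^{-1}(a_i)\,\varphi_i .$$ Moreover, the estimate $$\|(\Gamma_m^{r_m})^{-1}(w)\|_{L^\infty(I_m;\mathbb{H})}\le C_m\,k_m^{1/2}\,\|w\|_{L^2(I_m;\mathbb{H})}$$ holds true, with $C_m:=\max_{1\le i\le n_m}C^{L^2}_{\lambda_i,r_m}$.
   Context: Setting. $\mathbb{H}$ and $\mathbb{X}$ are real Hilbert spaces, $\mathbb{X}$ densely and continuously embedded in $\mathbb{H}$ (Gelfand triple $\mathbb{X}\hookrightarrow\mathbb{H}\cong\mathbb{H}^\star\hookrightarrow\mathbb{X}^\star$). $\mathsf{A}:\mathbb{X}\to\mathbb{X}^\star$ is linear, self-adjoint (i.e. $\langle\mathsf{A}v,w\rangle=\langle\mathsf{A}w,v\rangle$), coercive ($\langle\mathsf{A}v,v\rangle\ge\alpha\|v\|_{\mathbb X}^2$, $\alpha>0$) and bounded ($|\langle\mathsf{A}v,w\rangle|\le\beta\|v\|_{\mathbb X}\|w\|_{\mathbb X}$, $\beta>0$). Let $0=t_0<\dots<t_M=T$, $I_m=(t_{m-1},t_m]$, $k_m=t_m-t_{m-1}$, $r_m\ge0$ an integer, and $\mathbb{X}_m\subset\mathbb{X}$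 a finite-dimensional subspace, $n_m=\dim\mathbb{X}_m$. $\mathbb{P}^{r_m}(I_m;\mathbb{X}_m)$ is the space of polynomials in $t\in I_m$ of degree at most $r_m$ with coefficients in $\mathbb{X}_m$; $\mathbb{P}^{r_m}(I_m)$ is the corresponding space of real-valued polynomials. Values of polynomials at $t_{m-1}$ are limits from the right. $\mathsf{A}_m:\mathbb{X}_m\to\mathbb{X}_m$ is given by $(\mathsf{A}_mu,v)_{\mathbb H}=\langle\mathsf{A}u,v\rangle_{\mathbb{X}^\star\times\mathbb{X}}$ for all $v\in\mathbb{X}_m$; $\{\varphi_i\}_{i=1}^{n_m}$ is an $\mathbb{H}$-orthonormal basis of $\mathbb{X}_m$ with $\mathsf{A}_m\varphi_i=\lambda_i\varphi_i$, $\lambda_i>0$. Lifting operator: for $z\in\mathbb{X}_m$, $L_m^{r_m}(z)\in\mathbb{P}^{r_m}(I_m;\mathbb{X}_m)$ is defined by $\int_{I_m}(L_m^{r_m}(z),V)_{\mathbb H}\,dt=(z,V(t_{m-1}))_{\mathbb H}$ for all $V\in\mathbb{P}^{r_m}(I_m;\mathbb{X}_m)$. For $z\in\mathbb{R}$, $L_m^{r_m}(z)\in\mathbb{P}^{r_m}(I_m)$ denotes the scalar version (with $\mathbb{H}=\mathbb{X}_m=\mathbb{R}$). Discrete parabolic operators: $\Gamma_m^{r_m}(U):=U'+L_m^{r_m}(U(t_{m-1}))+\mathsf{A}_mU$ on $\mathbb{P}^{r_m}(I_m;\mathbb{X}_m)$, and, for $\lambda>0$, $\Gamma_{\lambda,m}^{r_m}(v):=v'+L_m^{r_m}(v(t_{m-1}))+\lambda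 v$ on $\mathbb{P}^{r_m}(I_m)$; both are isomorphisms. Constants: $C^{L^2}_{\lambda,r_m}:=\Upsilon(r_m,k_m\lambda)\left\|\frac{e_{\lambda,m}}{e_{\lambda,m}(t_{m-1})}\right\|_{L^\infty(I_m)}+1$, where $\Upsilon(r,\varrho):=\left(\frac{3}{2(2r+1)+\varrho}\right)^{1/2}$, $e_{\lambda,m}(t):=e^{-\lambda(t-t_{m-1})}-\psi_\lambda^{r_m}(t)$, and $\psi_\lambda^{r_m}:=(\Gamma_{\lambda,m}^{r_m})^{-1}(L_m^{r_m}(1))$. For $\lambda>0$ one has $e_{\lambda,m}(t_{m-1})>0$, so the quotient is well defined. *)

(* Defs.v *)
From HB Require Import structures.
From mathcomp Require Import all_boot all_order all_algebra.
From mathcomp Require Import all_classical all_reals all_analysis.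

Set Implicit Arguments.
Unset Strict Implicit.
Unset Printing Implicit Defensive.

Import Order.TTheory GRing.Theory Num.Theory.
Import numFieldNormedType.Exports.

Local Open Scope classical_set_scope.
Local Open Scope ring_scope.

Section linear_algebra.
Context {R : realType} {V : lmodType R}.

Definition lin_span n (b : 'I_n -> V) : set V :=
  [set v | exists c : 'I_n -> R, v = \sum_(i < n) c i *: b i].

Definition lin_free n (b : 'I_n -> V) : Prop :=
  forall c : 'I_n -> R, \sum_(i < n) c i *: b i = 0 -> forall i, c i = 0.

Definition basis_for (S : set V) n (b : 'I_n -> V) : Prop :=
  lin_free b /\ S = lin_span b.

Definition subspace_of_dim (n : nat) (S : set V) : Prop :=
  exists b : 'I_n -> V, basis_for S b.

End linear_algebra.

(* Real Hilbert space: the inner product induces the norm of a complete space. *)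
Definition hilbert_product {R : realType} {H : completeNormedModType R}
    (ip : {dot H for (@idfun R)}) : Prop :=
  forall u : H, ip u u = `|u| ^+ 2.

Definition dual_space {R : realType} (X : normedModType R) : set (X -> R^o) :=
  [set f | linear f /\ continuous f].

Definition Lnorm_on {R : realType} {V : normedModType R} (p : \bar R)
    (I : set R) (f : R -> V) : \bar R :=
  'N[lebesgue_measure]_p[(fun t => `|f t|%:E) \_ I]%E.

Section discrete_operators.
Context {R : realType} {V : normedModType R}.

(* A polynomial on a nondegenerate interval is identified with its unique
   polynomial extension to the whole line; its limit from the right at the left
   endpoint is then its value there. *)
Definition poly_space (r : nat) (S : set V) : set (R -> V) :=
  [set U | exists c : 'I_r.+1 -> V,
     (forall j, S (c j)) /\ U = fun t => \sum_(j < r.+1) t ^+ j *: c j].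

(* In the remaining definitions P is a space of polynomials on ]a, b], whose
   coefficient space carries the inner product ip.  The elements picked by xget
   and 'pinv_ are the unique ones with the stated property; the default value 0
   is never used on a genuine polynomial space. *)
Definition lifting (ip : V -> V -> R) (a b : R) (P : set (R -> V)) (z : V) :
    R -> V :=
  xget (cst 0) [set W | P W /\ forall U, P U ->
    (\int[lebesgue_measure]_(t in `]a, b]) ip (W t) (U t))%R = ip z (U a)].

Definition parabolic (ip : V -> V -> R) (a b : R) (P : set (R -> V))
    (B : V -> V) (U : R -> V) : R -> V :=
  fun t => U^`()%classic t + lifting ip a b P (U a) t + B (U t).

Definition parabolic_inv (ip : V -> V -> R) (a b : R) (P : set (R -> V))
    (B : V -> V) : (R -> V) -> R -> V :=
  'pinv_(fun=> cst 0) P (parabolic ip a b P B).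

Definition discrete_op (ip : V -> V -> R) (S : set V) (A : V -> V -> R)
    (u : V) : V :=
  xget 0 [set y | S y /\ forall v, S v -> ip y v = A u v].

End discrete_operators.

Section scalar.
Context {R : realType}.
Implicit Types (a b lambda : R) (r : nat).

Definition scalar_prod : R^o -> R^o -> R := fun x y => x * y.

Definition scalar_poly r : set (R -> R^o) := poly_space r [set: R^o].

Definition scalar_lifting a b r (z : R) : R -> R^o :=
  lifting scalar_prod a b (scalar_poly r) z.

Definition scalar_parabolic_inv a b r lambda : (R -> R^o) -> R -> R^o :=
  parabolic_inv scalar_prod a b (scalar_poly r) (fun x : R^o => lambda * x).

Definition psi a b r lambda : R -> R^o :=
  scalar_parabolic_inv a b r lambda (scalar_lifting a b r 1).

Definition err a b r lambda : R -> R^o :=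
  fun t => expR (- lambda * (t - a)) - psi a b r lambda t.

Definition Upsilon r (rho : R) : R :=
  Num.sqrt (3 / (2 * (2 * r%:R + 1) + rho)).

Definition C_L2 a b r lambda : \bar R :=
  ((Upsilon r ((b - a) * lambda))%:E *
   Lnorm_on +oo%E `]a, b] (fun t => (err a b r lambda t / err a b r lambda a)%R : R^o)
   + 1)%E.

End scalar.

(* Main.v *)
Require Import Defs.
From HB Require Import structures.
From mathcomp Require Import all_boot all_order all_algebra.
From mathcomp Require Import all_classical all_reals all_analysis.
From mathcomp Require Import ess_sup_inf ring lra.

Set Implicit Arguments.
Unset Strict Implicit.
Unset Printing Implicit Defensive.

Import Order.TTheory GRing.Theory Num.Theory.
Import numFieldNormedType.Exports.

Local Open Scope classical_set_scope.
Local Open Scope ring_scope.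

(** In the basis phi_i the discrete parabolic operator is diagonal: A_m acts on
    the coordinates by the eigenvalues lambda_i, and the lifting operator acts
    coordinatewise as z_i |-> z_i * L(1), where the real polynomial L(1) is the
    element ell of P^r that represents evaluation at the left endpoint a in
    L^2(]a, b]).  So a polynomial with coordinates p_i is sent to the one with
    coordinates p_i' + p_i(a) ell + lambda_i p_i ([parabolic_poly_comb]), and
    the formula for the inverse follows from the bijectivity of the scalar
    operators ([poly_op_onto], [parabolic_inv_poly_comb]).  The scalar problem
    is itself the case of the one-element basis 1 of the real line.

    For the estimate, let v solve the scalar equation v' + v(a) ell + lambda v
    = f on P^r, with k = b - a, and let e(t) = exp(-lambda (t - a)) - psi(t) be
    the error for the right-hand side f = ell.  It satisfies
    e' + lambda e = - e(a) ell, and e(a) <> 0 because psi is a polynomial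
    ([dg_err_initial_neq0]).  Then z = v - (v(a) / e(a)) e
    satisfies z' + lambda z = f and z(a) = 0, because the terms in ell cancel,
    so |z| <= k^(1/2) |f| in the L^2 norm of f ([duhamel_le]).  Hence
    |v(t)| <= k^(1/2) |f| + |v(a)| |e(t) / e(a)|, and it remains to bound the
    initial value ([poly_op_initial_le]):
      v(a)^2 (2r + 1 + k lambda) <= k |f|^2.
    Write g = f - lambda v = v' + v(a) ell and let K in P^r be orthogonal to
    all polynomials of degree less than r, that is, K is a multiple of the
    Legendre polynomial.  Testing g with K gives v(a) K(a), and integrating
    ((X - b) K^2)' gives k K(a)^2 = (2r + 1) |K|^2, so by Cauchy-Schwarz
    (2r + 1) v(a)^2 <= k |g|^2.  Testing the equation with v expresses
    |f|^2 - |g|^2 as lambda (v(a)^2 + v(b)^2) + lambda^2 |v|^2, which is at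
    least lambda v(a)^2.

    Summing the squares of the coordinate bounds, by orthonormality of the
    phi_i, gives the vector-valued estimate. *)

(** * Real polynomials and their integrals *)

Section PolynomialAlgebra.
Context {R : realType}.
Implicit Types (p q : {poly R}) (a b : R).

(** The polynomials of size at most n form a finite-dimensional space.  This
    turns uniqueness into existence, both for the Riesz representatives and for
    the solutions of the scalar problem below. *)
Lemma linear_endo_onto n (f : {linear {poly R} -> {poly R}}) :
  (forall p, (size p <= n)%N -> (size (f p) <= n)%N) ->
  (forall p, (size p <= n)%N -> f p = 0 -> p = 0) ->
  forall q, (size q <= n)%N -> exists2 p : {poly R}, (size p <= n)%N & f p = q.
Proof.
move=> f_size f_inj q q_size.
pose G := lin1_mx (@poly_rV R n \o f \o @rVpoly R n).
have GE (u : 'rV_n) : rVpoly (u *m G) = f (rVpoly u).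
  by rewrite mul_rV_lin1 /= poly_rV_K// f_size// size_poly.
have G_unit : G \in unitmx.
  rewrite -row_free_unit -kermx_eq0; apply/eqP/row_matrixP => i; rewrite row0.
  have /(congr1 (@rVpoly R n)) : row i (kermx G) *m G = 0.
    by rewrite -row_mul mulmx_ker row0.
  rewrite GE linear0 => /f_inj; rewrite size_poly => /(_ isT) /(congr1 (@poly_rV R n)).
  by rewrite rVpolyK linear0.
exists (rVpoly (poly_rV q *m invmx G)); first exact: size_poly.
by rewrite -GE mulmxKV// poly_rV_K.
Qed.

Lemma antiderivative p : exists P : {poly R}, P^`() = p.
Proof.
exists (\poly_(i < (size p).+1) (p`_i.-1 / i%:R)); apply/polyP => i.
rewrite coef_deriv coef_poly ltnS; case: ltnP => [_|/leq_sizeP-> //].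
  by rewrite -[LHS]mulr_natr divfK ?pnatr_eq0.
by rewrite mul0rn.
Qed.

Lemma poly_eq0_oo p a b : a < b -> (forall x, a < x < b -> p.[x] = 0) -> p = 0.
Proof.
move=> ab p0; apply/eqP/negP => /negP p_neq0.
pose s := [seq a + (b - a) / i.+2%:R | i <- iota 0 (size p)].
have s_roots : all (root p) s.
  apply/allP => _ /mapP[i _ ->]; apply/rootP/p0.
  rewrite ltrDl divr_gt0 ?subr_gt0 ?ltr0n//= -ltrBrDl ltr_pdivrMr ?ltr0n//.
  by rewrite ltr_pMr ?subr_gt0// ltr1n.
have s_uniq : uniq s.
  rewrite map_inj_uniq ?iota_uniq// => i j /addrI /mulfI.
  rewrite subr_eq0 gt_eqF// => /(_ isT) /invr_inj /eqP.
  by rewrite eqr_nat => /eqP[].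
by have := max_poly_roots p_neq0 s_roots s_uniq; rewrite size_map size_iota ltnn.
Qed.

Lemma horner_fun_inj : injective (fun p => horner p : R -> R).
Proof.
move=> p q /= pq; apply/eqP; rewrite -subr_eq0; apply/eqP.
by apply: (@poly_eq0_oo _ 0 1) => // x _; rewrite hornerD hornerN pq subrr.
Qed.

(** With [antiderivative], this compares integrals over subintervals. *)
Lemma horner_ndecr p a b : a <= b ->
  (forall x, a < x < b -> 0 <= (p^`()).[x]) -> p.[a] <= p.[b].
Proof.
move=> ab dp; apply: (@ger0_derive1_le_cc R (horner p) a b) => //.
- by move=> x; rewrite in_itv/= -derivE; exact: dp.
- exact/continuous_subspaceT/continuous_horner.
- by rewrite in_itv/= lexx.
- by rewrite in_itv/= lexx andbT.
Qed.

End PolynomialAlgebra.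

Section PolynomialIntegral.
Context {R : realType}.
Implicit Types (p q : {poly R}) (a b : R).

Definition poly_int a b p : R :=
  (\int[lebesgue_measure]_(x in `]a, b]) p.[x])%R.

Lemma poly_integrable a b p :
  (@lebesgue_measure R).-integrable `]a, b] (EFin \o horner p).
Proof.
have : (@lebesgue_measure R).-integrable `[a, b] (EFin \o horner p).
  apply: continuous_compact_integrable; first exact: segment_compact.
  exact/continuous_subspaceT/continuous_horner.
apply: integrableS => //.
by apply: subset_itvr; rewrite bnd_simp.
Qed.

Lemma poly_int_is_scalar a b : scalar (poly_int a b).
Proof.
move=> c p q; rewrite /poly_int.
rewrite (_ : (fun x => _) = (fun x => c * p.[x] + q.[x])); last first.
  by apply/funext => x; rewrite !hornerE.
rewrite RintegralD//=; first last.
- exact: poly_integrable.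
- rewrite (_ : _ \o _ = EFin \o horner (c *: p)); last first.
    by apply/funext => x; rewrite /= hornerZ.
  exact: poly_integrable.
by rewrite RintegralZl//; exact: poly_integrable.
Qed.

HB.instance Definition _ a b :=
  GRing.isLinear.Build R {poly R} R *%R (poly_int a b) (@poly_int_is_scalar a b).

Lemma poly_int0 a b : poly_int a b 0 = 0. Proof. exact: linear0. Qed.

Lemma poly_intD a b : {morph poly_int a b : p q / p + q}.
Proof. exact: linearD. Qed.

Lemma poly_intB a b : {morph poly_int a b : p q / p - q}.
Proof. exact: linearB. Qed.

Lemma poly_intZ a b c p : poly_int a b (c *: p) = c * poly_int a b p.
Proof. exact: linearZ. Qed.

Lemma poly_int_ge0 a b p :
  (forall x, 0 <= p.[x]) -> 0 <= poly_int a b p.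
Proof. by move=> p0; apply: Rintegral_ge0 => x _. Qed.

Lemma poly_int_sqr_ge0 a b p : 0 <= poly_int a b (p * p).
Proof. by apply: poly_int_ge0 => x; rewrite hornerM -expr2 sqr_ge0. Qed.

Lemma poly_int_deriv a b p : a < b -> poly_int a b p^`() = p.[b] - p.[a].
Proof.
move=> ab; rewrite /poly_int Rintegral_itv_obnd_cbnd; last first.
  exact: poly_integrable.
rewrite /Rintegral (@continuous_FTC2 _ _ (horner p))//.
- exact/continuous_subspaceT/continuous_horner.
- split; first by move=> x _; exact: derivable_horner.
  + by apply: cvg_at_right_filter; exact: continuous_horner.
  + by apply: cvg_at_left_filter; exact: continuous_horner.
- by move=> x _; rewrite derivE.
Qed.

(** The antiderivative of p^2 is monotone and takes equal values at a and b,
    so it is constant on [a, b] and therefore constant as a polynomial. *)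
Lemma poly_int_sqr_eq0 a b p : a < b -> poly_int a b (p * p) = 0 -> p = 0.
Proof.
move=> ab; have [P PE] := antiderivative (p * p).
rewrite -PE poly_int_deriv// => /eqP; rewrite subr_eq0 => /eqP Pab.
have dP_ge0 x : 0 <= (P^`()).[x] by rewrite PE hornerM -expr2 sqr_ge0.
have Pcst x : a < x < b -> (P - P.[a]%:P).[x] = 0.
  move=> /andP[ax xb]; rewrite !hornerE; apply/eqP; rewrite subr_eq0 eq_le.
  by rewrite -{1}Pab !horner_ndecr// ltW.
have /(congr1 (@deriv R)) := poly_eq0_oo ab Pcst.
rewrite derivB derivC subr0 deriv0 PE => /eqP.
by rewrite mulf_eq0 orbb => /eqP.
Qed.

Lemma poly_int_cauchy_schwarz a b p q : a < b ->
  poly_int a b (p * q) ^+ 2 <= poly_int a b (p * p) * poly_int a b (q * q).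
Proof.
move=> ab; set J := poly_int a b.
have J_ge0 s : 0 <= J (s * s) by exact: poly_int_sqr_ge0.
have [q0|q_neq0] := eqVneq (J (q * q)) 0.
  by rewrite (poly_int_sqr_eq0 ab q0) !mulr0 /J poly_int0 mulr0 expr0n.
have Jq : 0 < J (q * q) by rewrite lt_neqAle eq_sym q_neq0 J_ge0.
set c := J (q * q) in Jq *; set d := J (p * q).
have := J_ge0 (c *: p - d *: q).
have -> : (c *: p - d *: q) * (c *: p - d *: q) =
    (c * c) *: (p * p) - (c * d) *: (p * q) - (c * d) *: (p * q)
      + (d * d) *: (q * q).
  by rewrite -!mul_polyC !rmorphM/=; ring.
have -> : J ((c * c) *: (p * p) - (c * d) *: (p * q) - (c * d) *: (p * q)
      + (d * d) *: (q * q)) = c * (J (p * p) * c - d ^+ 2).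
  by rewrite /J poly_intD !poly_intB !poly_intZ -/J -/c -/d; ring.
by rewrite pmulr_rge0// subr_ge0.
Qed.

End PolynomialIntegral.

(** * The scalar discrete parabolic operator *)

Section ScalarOperator.
Context {R : realType}.
Implicit Types (p q f v : {poly R}) (a b lambda : R) (r n : nat).

Lemma scalar_poly_basis n (phi : {scalar {poly R}}) q : (size q <= n)%N ->
  phi q = \sum_(i < n) q`_i * phi 'X^i.
Proof.
move=> q_size.
have {1}-> : q = \sum_(i < n) q`_i *: 'X^i.
  rewrite -poly_def; apply/polyP => i; rewrite coef_poly.
  by case: ltnP => // ni; rewrite nth_default// (leq_trans q_size).
by rewrite linear_sum; apply: eq_bigr => i _; rewrite linearZ.
Qed.

(** Packs the moments of p against the monomials into a polynomial, so that
    [linear_endo_onto] applies to the Gram map. *)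
Definition test_coefs a b n p : {poly R} :=
  \poly_(i < n) poly_int a b (p * 'X^i).

Lemma test_coefs_is_linear a b n : linear (test_coefs a b n).
Proof.
move=> c p q; apply/polyP => i; rewrite coefD coefZ !coef_poly.
case: ltnP => _; last by rewrite mulr0 addr0.
by rewrite mulrDl -scalerAl poly_intD poly_intZ.
Qed.

HB.instance Definition _ a b n := GRing.isLinear.Build R {poly R} {poly R} *:%R
  (test_coefs a b n) (@test_coefs_is_linear a b n).

Definition poly_int_mul a b p q : R := poly_int a b (p * q).

Lemma poly_int_mul_is_scalar a b p : scalar (poly_int_mul a b p).
Proof.
by move=> c q s; rewrite /poly_int_mul mulrDr -scalerAr poly_intD poly_intZ.
Qed.

HB.instance Definition _ a b p := GRing.isLinear.Build R {poly R} R *%R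
  (poly_int_mul a b p) (@poly_int_mul_is_scalar a b p).

(** Riesz representation in polynomials of size at most n: the Gram map is
    injective because a polynomial in its kernel is orthogonal to itself. *)
Lemma poly_riesz a b n (phi : {scalar {poly R}}) : a < b ->
  exists2 p : {poly R}, (size p <= n)%N &
    forall q : {poly R}, (size q <= n)%N -> poly_int a b (p * q) = phi q.
Proof.
move=> ab.
have test_E p (i : 'I_n) : poly_int_mul a b p 'X^i = (test_coefs a b n p)`_i.
  by rewrite coef_poly ltn_ord.
have [|||p p_size pE] := @linear_endo_onto R n (test_coefs a b n) _ _
  (\poly_(i < n) phi 'X^i).
- by move=> p _; exact: size_poly.
- move=> p p_size p0; apply: (poly_int_sqr_eq0 ab).
  rewrite -/(poly_int_mul a b p p) (scalar_poly_basis _ p_size) big1// => i _.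
  by rewrite /= test_E p0 coef0 mulr0.
- exact: size_poly.
exists p => // q q_size.
rewrite -/(poly_int_mul a b p q) !(scalar_poly_basis _ q_size).
apply: eq_bigr => i _; congr (_ * _).
by rewrite /= test_E pE coef_poly ltn_ord.
Qed.

(** The polynomial ell is the lifting L(1) of the real number 1, for
    polynomials of degree at most r on ]a, b]. *)
Definition is_eval_poly a b r (ell : {poly R}) : Prop :=
  (size ell <= r.+1)%N /\
  forall q, (size q <= r.+1)%N -> poly_int a b (ell * q) = q.[a].

Lemma eval_poly_exists a b r : a < b -> exists ell, is_eval_poly a b r ell.
Proof.
move=> ab; have [ell] := poly_riesz r.+1 (horner_eval a) ab.
by exists ell; split.
Qed.

(** K is a multiple of the Legendre polynomial of degree r, obtained without
    an explicit formula as the representative of the coefficient of 'X^r.  The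
    value of K at a follows by integrating
    ((X - b) K^2)' = K^2 + 2 K ((X - b) K'), where (X - b) K' may be replaced
    by r K because K is orthogonal to lower degrees. *)
Lemma extremal_poly_exists a b r : a < b -> exists K : {poly R},
  [/\ (size K <= r.+1)%N, K != 0,
      forall q, (size q <= r)%N -> poly_int a b (K * q) = 0 &
      (b - a) * K.[a] ^+ 2 = (2 * r%:R + 1) * poly_int a b (K * K)].
Proof.
move=> ab; have [K K_size KE] := poly_riesz r.+1 (coefp r) ab.
have K_orth q : (size q <= r)%N -> poly_int a b (K * q) = 0.
  by move=> q_size; rewrite KE ?(leq_trans q_size)//= nth_default.
exists K; split => //.
  apply/eqP => K0; have := KE 'X^r; rewrite size_polyXn K0 mul0r poly_int0.
  by move=> /(_ (leqnn _)) /=; rewrite coefXn eqxx => /eqP; rewrite eq_sym oner_eq0.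
(* The coefficients of 'X^r in (X - b) K' and in r K agree. *)
have K_euler : (size (('X - b%:P) * K^`() - r%:R *: K)%R <= r)%N.
  apply/leq_sizeP => j rj.
  rewrite mulrBl mul_polyC !coefB coefXM !coefZ !coef_deriv.
  have -> : K`_j.+1 = 0 by rewrite nth_default// (leq_trans K_size).
  rewrite mul0rn mulr0 subr0.
  case: j rj => [|j] rj /=.
    by move: rj; rewrite leqn0 => /eqP ->; rewrite mul0r subrr.
  have [->|jr] := eqVneq r j.+1; first by rewrite mulr_natl subrr.
  by rewrite nth_default ?mul0rn ?mulr0 ?subrr// (leq_trans K_size)// ltn_neqAle jr.
have := K_orth _ K_euler; rewrite mulrBr -scalerAr poly_intB poly_intZ.
have := poly_int_deriv (('X - b%:P) * (K * K)) ab.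
rewrite !derivM derivXsubC mul1r !hornerM !hornerXsubC subrr mul0r sub0r.
rewrite (_ : _ + _ = K * K + 2 *: (K * (('X - b%:P) * K^`()))); last first.
  by rewrite -mul_polyC rmorphMn/=; ring.
by rewrite poly_intD poly_intZ; lra.
Qed.

Section Operator.
Context (a b : R) (r : nat) (ell : {poly R}).
Context (ab : a < b) (ellP : is_eval_poly a b r ell).

(** The scalar discrete parabolic operator: by linearity of the lifting
    operator, L(p(a)) = p(a) ell. *)
Definition poly_op lambda p : {poly R} := p^`() + p.[a] *: ell + lambda *: p.

Lemma poly_op_is_linear lambda : linear (poly_op lambda).
Proof.
move=> c p q; rewrite /poly_op derivD derivZ !hornerE.
rewrite -!mul_polyC !rmorphD !rmorphM /=; ring.
Qed.

HB.instance Definition _ lambda := GRing.isLinear.Build R {poly R} {poly R} *:%R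
  (poly_op lambda) (@poly_op_is_linear lambda).

Lemma size_poly_op lambda p : (size p <= r.+1)%N -> (size (poly_op lambda p) <= r.+1)%N.
Proof.
move=> p_size; rewrite !(leq_trans (size_polyD _ _))// geq_max.
rewrite (leq_trans (size_scale_leq _ _))// andbT.
rewrite (leq_trans (size_polyD _ _))// geq_max.
rewrite (leq_trans (size_scale_leq _ _)) ?ellP.1// andbT.
by rewrite (leq_trans (size_poly _ _))// (leq_trans (leq_pred _)).
Qed.

(** Testing with p itself: p' p integrates to half the increment of p^2, and
    the lifting term contributes p(a)^2. *)
Lemma poly_op_energy lambda p : (size p <= r.+1)%N ->
  2 * poly_int a b (poly_op lambda p * p) =
  p.[b] ^+ 2 + p.[a] ^+ 2 + 2 * lambda * poly_int a b (p * p).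
Proof.
move=> p_size.
have -> : poly_op lambda p * p =
    p^`() * p + p.[a] *: (ell * p) + lambda *: (p * p).
  by rewrite !mulrDl -!scalerAl.
rewrite !poly_intD !poly_intZ ellP.2//.
have := poly_int_deriv (p * p) ab.
rewrite derivM poly_intD !hornerM [p * _]mulrC; lra.
Qed.

Lemma poly_op_inj lambda p : 0 < lambda -> (size p <= r.+1)%N ->
  poly_op lambda p = 0 -> p = 0.
Proof.
move=> lambda_gt0 p_size p0; apply: (poly_int_sqr_eq0 ab).
have := poly_op_energy lambda p_size; rewrite p0 mul0r poly_int0.
have := poly_int_sqr_ge0 a b p; have := sqr_ge0 p.[a]; have := sqr_ge0 p.[b]; nra.
Qed.

Lemma poly_op_onto lambda q : 0 < lambda -> (size q <= r.+1)%N ->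
  exists2 p : {poly R}, (size p <= r.+1)%N & poly_op lambda p = q.
Proof.
move=> lambda_gt0; apply: linear_endo_onto => p; first exact: size_poly_op.
exact: poly_op_inj.
Qed.

(** Two identities are combined: the test of g = f - lambda v with the
    Legendre-type polynomial K bounds v(a)^2 by |g|^2, and the energy identity
    shows by how much |f|^2 exceeds |g|^2. *)
Lemma poly_op_initial_le lambda v f : 0 < lambda ->
  (size v <= r.+1)%N -> poly_op lambda v = f ->
  v.[a] ^+ 2 * (2 * r%:R + 1 + (b - a) * lambda) <=
    (b - a) * poly_int a b (f * f).
Proof.
move=> lambda_gt0 v_size vf.
have [K [K_size K_neq0 K_orth KE]] := extremal_poly_exists r ab.
pose g := v^`() + v.[a] *: ell.
have fE : f = g + lambda *: v by rewrite -vf.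
have KK : 0 < poly_int a b (K * K).
  rewrite lt_neqAle poly_int_sqr_ge0 andbT.
  by apply/eqP => /esym /(poly_int_sqr_eq0 ab)/eqP; rewrite (negPf K_neq0).
have gK : poly_int a b (g * K) = v.[a] * K.[a].
  rewrite mulrDl -scalerAl poly_intD poly_intZ ellP.2// [_ * K]mulrC K_orth ?add0r//.
  have [->|v_neq0] := eqVneq v 0; first by rewrite deriv0 size_poly0.
  by rewrite -ltnS (leq_trans (lt_size_deriv _)).
have gg : (2 * r%:R + 1) * v.[a] ^+ 2 <= (b - a) * poly_int a b (g * g).
  rewrite -(ler_pM2r KK) mulrAC -KE -[leLHS]mulrA -[leRHS]mulrA.
  by rewrite ler_pM2l ?subr_gt0// -exprMn mulrC -gK poly_int_cauchy_schwarz.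
have fg : poly_int a b (f * f) =
    poly_int a b (g * g) + 2 * lambda * poly_int a b (f * v)
      - lambda ^+ 2 * poly_int a b (v * v).
  rewrite (_ : f * f = g * g + (2 * lambda) *: (f * v) - lambda ^+ 2 *: (v * v)).
    by rewrite poly_intB poly_intD !poly_intZ.
  by rewrite fE -!mul_polyC !rmorphM/= !rmorphMn/=; ring.
have vv := poly_int_sqr_ge0 a b v.
have := poly_op_energy lambda v_size; rewrite vf => fv.
have k_gt0 : 0 < b - a by rewrite subr_gt0.
have := mulr_ge0 (mulr_ge0 (ltW k_gt0) (ltW lambda_gt0)) (sqr_ge0 v.[b]).
have := mulr_ge0 (mulr_ge0 (ltW k_gt0) (sqr_ge0 lambda)) vv.
have := congr1 ( *%R ((b - a) * lambda)) fv.
rewrite fg; lra.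
Qed.

End Operator.
End ScalarOperator.

(** * Pointwise bounds for the scalar problem *)

Section ScalarBounds.
Context {R : realType}.
Implicit Types (p q f v psi : {poly R}) (a b lambda c k j s t : R) (h : R -> R).

(** Optimization in c: the choice c = x / k turns the hypothesis into
    x^2 <= k j. *)
Lemma le_sqrt_mul k j (x : R) : 0 < k -> 0 <= j ->
  (forall c, 0 < c -> 2 * c * x <= c ^+ 2 * k + j) ->
  x <= Num.sqrt k * Num.sqrt j.
Proof.
move=> k_gt0 j_ge0 xkj; rewrite leNgt; apply/negP => x_gt.
have x_gt0 : 0 < x by apply: le_lt_trans x_gt; rewrite mulr_ge0// sqrtr_ge0.
have := xkj (x / k) (divr_gt0 x_gt0 k_gt0).
have -> : (x / k) ^+ 2 * k = x ^+ 2 / k by field; rewrite gt_eqF.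
have -> : 2 * (x / k) * x = 2 * (x ^+ 2 / k) by ring.
rewrite mulr_natl mulr2n lerD2l ler_pdivrMr// leNgt => /negP; apply.
have jk_ge0 : 0 <= j * k by rewrite mulr_ge0// ltW.
rewrite -(sqr_sqrtr jk_ge0) ltr_pXn2r ?nnegrE ?sqrtr_ge0 ?(ltW x_gt0)//.
by rewrite sqrtrM// mulrC.
Qed.

(** The Duhamel formula h(t) = int_a^t exp(-lambda (t - s)) f(s) ds bounds
    h(t) by int_a^t |f|, and 2 c |f| <= c^2 + f^2.  The integration is carried
    out by monotonicity: the derivative of
    s |-> 2 c exp(lambda (s - t)) h(s) - (c^2 s + F(s)), with F' = f^2, is
    2 c exp(lambda (s - t)) f(s) - c^2 - f(s)^2, which is nonpositive for
    s <= t. *)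
Lemma duhamel_upper a b lambda f h : a < b -> 0 < lambda ->
  (forall s, is_derive s (1 : R) h (f.[s] - lambda * h s)) -> h a = 0 ->
  forall t, a <= t <= b -> forall c, 0 < c ->
  2 * c * h t <= c ^+ 2 * (b - a) + poly_int a b (f * f).
Proof.
move=> ab lambda_gt0 dh ha0 t /andP[at_ tb] c c_gt0.
have [F FE] := antiderivative (f * f).
pose G := (c ^+ 2) *: 'X + F.
pose g := (2 * c) *: ((expR \o horner (lambda *: ('X - t%:P))) * h) - horner G.
have dg s : is_derive s 1 g (2 * c * (expR (lambda * (s - t)) * f.[s]) -
    (c ^+ 2 + f.[s] ^+ 2)).
  have dh_s := dh s; rewrite /g; apply: is_derive_eq.
  rewrite /G /= derivD !derivZ derivXsubC derivX FE !hornerE /=.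
  by rewrite /GRing.scale/=; ring.
have g_le s : a < s < t -> g^`()%classic s <= 0.
  move=> /andP[_ st]; have dgs := dg s; rewrite derive1E derive_val.
  have : expR (lambda * (s - t)) <= 1.
    by rewrite -expR0 ler_expR pmulr_rle0// subr_le0 ltW.
  have := expR_gt0 (lambda * (s - t)); set e := expR _ => e_gt0 e_le1.
  have := sqr_ge0 (c - e * f.[s]).
  have : 0 <= (1 - e ^+ 2) * f.[s] ^+ 2.
    by rewrite mulr_ge0 ?sqr_ge0// subr_ge0 expr_le1// ltW.
  lra.
have : g t <= g a.
  apply: (@ler0_derive1_le_cc R g a t) => //.
  - apply: continuous_subspaceT => s; apply/differentiable_continuous.
    by apply/derivable1_diffP; case: (dg s).
  - by rewrite in_itv/= lexx andbT.
  - by rewrite in_itv/= lexx.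
have gE s : g s = 2 * c * (expR (lambda * (s - t)) * h s) - (c ^+ 2 * s + F.[s]).
  by rewrite /g /G !fctE /= !hornerE /= /GRing.scale/= mulrA.
rewrite !gE ha0 subrr mulr0 expR0 mul1r mulr0.
have : F.[t] <= F.[b].
  by apply: horner_ndecr => // x _; rewrite FE hornerM -expr2 sqr_ge0.
have : c ^+ 2 * t <= c ^+ 2 * b by rewrite ler_wpM2l// sqr_ge0.
by rewrite -FE poly_int_deriv//; lra.
Qed.

Lemma duhamel_le a b lambda f h : a < b -> 0 < lambda ->
  (forall s, is_derive s (1 : R) h (f.[s] - lambda * h s)) -> h a = 0 ->
  forall t, a <= t <= b ->
  `|h t| <= Num.sqrt (b - a) * Num.sqrt (poly_int a b (f * f)).
Proof.
move=> ab lambda_gt0 dh ha0 t atb.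
have ff := poly_int_sqr_ge0 a b f.
rewrite ler_norml lerNl; apply/andP; split.
  apply: le_sqrt_mul; rewrite ?subr_gt0//.
  rewrite -[f * f]mulrNN.
  apply: (@duhamel_upper a b lambda (- f) (- h)) => //.
    move=> s; have := dh s => ?; apply: is_derive_eq.
    by rewrite !fctE hornerN; ring.
  by rewrite fctE ha0 oppr0.
by apply: le_sqrt_mul; rewrite ?subr_gt0//; apply: (@duhamel_upper a b lambda).
Qed.

Section Bounds.
Context (a b : R) (r : nat) (ell : {poly R}).
Context (ab : a < b) (ellP : is_eval_poly a b r ell).

(** The error function of [err], for a polynomial psi that will solve the
    scalar problem with right-hand side ell. *)
Definition dg_err lambda psi : R -> R :=
  fun t => expR (- lambda * (t - a)) - psi.[t].

(** If the error vanished at a, then psi(a) = 1 and psi would solve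
    psi' + lambda psi = 0, which forces psi = 0 by comparing degrees. *)
Lemma dg_err_initial_neq0 lambda psi : 0 < lambda ->
  poly_op a ell lambda psi = ell -> dg_err lambda psi a != 0.
Proof.
move=> lambda_gt0 psiE; rewrite /dg_err subrr mulr0 expR0; apply/eqP => /subr0_eq psia.
have psi0 : psi != 0.
  by apply: contra_eq_neq psia => ->; rewrite horner0 oner_eq0.
have /(congr1 (size \o @polyseq R)) : lambda *: psi = - psi^`().
  move/eqP: psiE; rewrite -subr_eq0 /poly_op -psia scale1r addrAC addrK.
  by rewrite addrC addr_eq0 => /eqP.
rewrite /= size_scale ?gt_eqF// size_polyN => size_psi.
by have := lt_size_deriv psi0; rewrite -size_psi ltnn.
Qed.

Lemma is_derive_dg_err lambda psi s : poly_op a ell lambda psi = ell ->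
  is_derive s 1 (dg_err lambda psi)
    (- dg_err lambda psi a * ell.[s] - lambda * dg_err lambda psi s).
Proof.
move=> psiE.
have dpsi : psi^`().[s] = ell.[s] - psi.[a] * ell.[s] - lambda * psi.[s].
  by have := congr1 (horner^~ s) psiE; rewrite /poly_op !hornerE /=; lra.
have errE : dg_err lambda psi =
    (expR \o horner (- lambda *: ('X - a%:P))) - horner psi.
  by apply/funext => t; rewrite /dg_err !fctE /= !hornerE.
rewrite {1}errE; apply: is_derive_eq.
rewrite dpsi derivZ derivXsubC /dg_err !hornerE /= subrr mulr0 expR0.
by rewrite /GRing.scale/=; ring.
Qed.

(** The multiple (v(a) / e(a)) e of the error function carries the initial
    value and the lifting term of v; the remainder z solves z' + lambda z = f
    with z(a) = 0. *)
Lemma poly_op_pointwise_le lambda psi f v : 0 < lambda ->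
  poly_op a ell lambda psi = ell -> (size v <= r.+1)%N ->
  poly_op a ell lambda v = f -> forall t, a <= t <= b ->
  `|v.[t]| <= (Upsilon r ((b - a) * lambda) *
     `|dg_err lambda psi t / dg_err lambda psi a| + 1) *
     (Num.sqrt (b - a) * Num.sqrt (poly_int a b (f * f))).
Proof.
move=> lambda_gt0 psiE v_size vE t atb.
set E := dg_err lambda psi.
have Ea : E a != 0 by exact: dg_err_initial_neq0 psiE.
set N := _ * Num.sqrt _.
have va : `|v.[a]| <= Upsilon r ((b - a) * lambda) * N.
  have k_gt0 : 0 < b - a by rewrite subr_gt0.
  have kl_gt0 : 0 < (b - a) * lambda by rewrite mulr_gt0.
  have r_ge0 : 0 <= r%:R :> R by rewrite ler0n.
  have D_gt0 : 0 < 2 * (2 * r%:R + 1) + (b - a) * lambda by lra.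
  have D_ge0 : 0 <= 3 / (2 * (2 * r%:R + 1) + (b - a) * lambda).
    by rewrite divr_ge0// ltW.
  rewrite /N /Upsilon -(sqrtrM _ (ltW k_gt0)) -(sqrtrM _ D_ge0).
  rewrite -sqrtr_sqr ler_wsqrtr// mulrAC ler_pdivlMr//.
  (* The bound 3 / (2 (2 r + 1) + k lambda) is weaker than
     1 / (2 r + 1 + k lambda). *)
  have := poly_op_initial_le ab ellP lambda_gt0 v_size vE.
  have := mulr_ge0 (sqr_ge0 v.[a]) r_ge0.
  have := mulr_ge0 (sqr_ge0 v.[a]) (ltW kl_gt0).
  have := sqr_ge0 v.[a].
  lra.
pose z : R -> R := horner v - (v.[a] / E a) *: E.
have zE s : z s = v.[s] - v.[a] / E a * E s by [].
have zt : `|z t| <= N.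
  apply: (@duhamel_le a b lambda f) => //; last first.
    by rewrite zE divfK// subrr.
  move=> s; have := is_derive_dg_err s psiE => ?.
  rewrite -vE; apply: is_derive_eq; rewrite -/E /poly_op !hornerE zE.
  by rewrite /GRing.scale /=; field.
have -> : v.[t] = z t + v.[a] * (E t / E a).
  by rewrite zE mulrA mulrAC subrK.
rewrite [leRHS]mulrDl mul1r addrC (le_trans (ler_normD _ _))// lerD// normrM.
by rewrite mulrAC ler_wpM2r.
Qed.

End Bounds.
End ScalarBounds.

(** * Discrete operators in orthonormal coordinates *)

Section Coordinates.
Context {R : realType} {V : normedModType R} {n : nat}.
Context (phi : 'I_n -> V).
Implicit Types (c d : 'I_n -> R) (p q u f v : 'I_n -> {poly R}).

Definition comb c : V := \sum_(i < n) c i *: phi i.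

Definition poly_comb p : R -> V := fun t => comb (fun i => (p i).[t]).

Lemma poly_space_spanP r (U : R -> V) :
  poly_space r (lin_span phi) U <->
  exists2 p : 'I_n -> {poly R}, (forall i, (size (p i) <= r.+1)%N) & U = poly_comb p.
Proof.
split=> [[C [/choice[d dE] ->]]|[p p_size ->]].
  exists (fun i => \poly_(j < r.+1) d (inord j) i).
    by move=> i; exact: size_poly.
  apply/funext => t; rewrite /poly_comb /comb.
  under eq_bigr do rewrite dE scaler_sumr.
  rewrite exchange_big /=; apply: eq_bigr => i _.
  rewrite horner_poly scaler_suml; apply: eq_bigr => j _.
  by rewrite inord_val scalerA mulrC.
exists (fun j => comb (fun i => (p i)`_j)); split.
  by move=> j; exists (fun i => (p i)`_j).
apply/funext => t; rewrite /poly_comb /comb.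
under [RHS]eq_bigr do rewrite scaler_sumr.
rewrite exchange_big /=; apply: eq_bigr => i _.
rewrite (horner_coef_wide _ (p_size i)) scaler_suml.
by apply: eq_bigr => j _; rewrite scalerA mulrC.
Qed.

Lemma derive1_poly_comb p : (poly_comb p)^`()%classic = poly_comb (fun i => (p i)^`()).
Proof.
apply/funext => t; rewrite derive1E.
have -> : poly_comb p = \sum_(i < n) (fun t => (p i).[t] *: phi i).
  by apply/funext => s; rewrite fct_sumE.
have dterm i : is_derive t 1 (fun t => (p i).[t] *: phi i)
    ((p i)^`().[t] *: phi i).
  have dp : differentiable (horner (p i)) t.
    by apply/derivable1_diffP; exact: derivable_horner.
  apply: DeriveDef; first by apply/derivable1_diffP; exact: differentiableZl.
  rewrite deriveE; last exact: differentiableZl.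
  by rewrite diffZl// -deriveE// derive_val.
by rewrite derive_val.
Qed.

Section Parabolic.
Context (ip : V -> V -> R) (a b : R) (r : nat) (ell : {poly R}).
Context (ip_comb : forall c d, ip (comb c) (comb d) = \sum_(i < n) c i * d i).
Context (ab : a < b) (ellP : is_eval_poly a b r ell).
Let P := poly_space r (lin_span phi).

Lemma comb_inj c d : comb c = comb d -> c = d.
Proof.
move=> cd; apply/funext => i.
have coord e : ip (comb e) (comb (fun j => (i == j)%:R)) = e i.
  rewrite ip_comb (bigD1 i)//= eqxx mulr1 big1 ?addr0// => j.
  by rewrite eq_sym => /negPf ->; rewrite mulr0.
by rewrite -(coord c) cd coord.
Qed.

Lemma poly_comb_inj p q : poly_comb p = poly_comb q -> p = q.
Proof.
move=> pq; apply/funext => i; apply: horner_fun_inj; apply/funext => t.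
by have /comb_inj/(congr1 (@^~ i)) := congr1 (@^~ t) pq.
Qed.

Lemma Rintegral_poly_comb p q :
  (\int[lebesgue_measure]_(t in `]a, b]) ip (poly_comb p t) (poly_comb q t))%R =
  \sum_(i < n) poly_int a b (p i * q i).
Proof.
rewrite -[RHS](linear_sum (poly_int a b)) /poly_int; congr Rintegral.
apply/funext => t; rewrite ip_comb horner_sum.
by apply: eq_bigr => i _; rewrite hornerM.
Qed.

(** Lifting is coordinatewise multiplication by ell.  Uniqueness: the
    difference u of two candidates is an admissible test function. *)
Lemma lifting_comb c :
  lifting ip a b P (comb c) = poly_comb (fun i => c i *: ell).
Proof.
have size_cell i : (size (c i *: ell) <= r.+1)%N.
  by rewrite (leq_trans (size_scale_leq _ _))// ellP.1.
rewrite /lifting; apply: xget_unique; first split.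
- by apply/poly_space_spanP; eexists; [|reflexivity].
- move=> _ /poly_space_spanP[u u_size ->].
  rewrite Rintegral_poly_comb ip_comb; apply: eq_bigr => i _.
  by rewrite -scalerAl poly_intZ ellP.2.
move=> _ [/poly_space_spanP[w w_size ->] wE].
pose u i := w i - c i *: ell.
have u_size i : (size (u i) <= r.+1)%N.
  by rewrite (leq_trans (size_polyD _ _))// geq_max size_polyN w_size size_cell.
have /wE : P (poly_comb u) by apply/poly_space_spanP; exists u.
rewrite Rintegral_poly_comb ip_comb => wuE.
have : \sum_(i < n) poly_int a b (u i * u i) = 0.
  transitivity (\sum_(i < n) (poly_int a b (w i * u i) - c i * (u i).[a])).
    apply: eq_bigr => i _.
    by rewrite {1}/u mulrBl -scalerAl poly_intB poly_intZ ellP.2.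
  by rewrite sumrB wuE subrr.
move/eqP; rewrite psumr_eq0 => [/allP u0|i _]; last first.
  exact: poly_int_sqr_ge0.
congr poly_comb; apply/funext => i; apply/eqP; rewrite -subr_eq0; apply/eqP.
by apply: (poly_int_sqr_eq0 ab); apply/eqP/u0; rewrite mem_index_enum.
Qed.

Context (B : V -> V) (lambda : 'I_n -> R).
Context (B_comb : forall c, B (comb c) = comb (fun i => lambda i * c i)).
Context (lambda_gt0 : forall i, 0 < lambda i).

Lemma parabolic_poly_comb p :
  parabolic ip a b P B (poly_comb p) =
  poly_comb (fun i => poly_op a ell (lambda i) (p i)).
Proof.
apply/funext => t; rewrite /parabolic derive1_poly_comb lifting_comb /poly_comb.
rewrite B_comb /comb -!big_split /=; apply: eq_bigr => i _.
by rewrite /poly_op !hornerD !hornerZ !scalerDl.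
Qed.

Lemma parabolic_inj : {in P &, injective (parabolic ip a b P B)}.
Proof.
move=> U W /set_mem/poly_space_spanP[p p_size ->].
move=> /set_mem/poly_space_spanP[q q_size ->].
rewrite !parabolic_poly_comb => /poly_comb_inj pq.
congr poly_comb; apply/funext => i; apply/eqP; rewrite -subr_eq0; apply/eqP.
apply: (poly_op_inj ab ellP (lambda_gt0 i)).
  by rewrite (leq_trans (size_polyD _ _))// geq_max size_polyN p_size q_size.
have /eqP := congr1 (@^~ i) pq.
by rewrite /= -subr_eq0 -linearB => /eqP.
Qed.

Lemma parabolic_inv_poly_comb f v : (forall i, (size (v i) <= r.+1)%N) ->
  (forall i, poly_op a ell (lambda i) (v i) = f i) ->
  parabolic_inv ip a b P B (poly_comb f) = poly_comb v.
Proof.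
move=> v_size vf.
have -> : f = fun i => poly_op a ell (lambda i) (v i) by apply/funext => i.
rewrite -parabolic_poly_comb /parabolic_inv pinvKV//; first exact: parabolic_inj.
by apply/mem_set/poly_space_spanP; exists v.
Qed.

End Parabolic.
End Coordinates.

(** * Norms on a time step *)

(** The instance for almost_everywhere is stated for the bare set system; the
    notation for almost everywhere statements wraps it in nbhs. *)
#[local] Instance ae_lebesgue_filter (R : realType) :
  Filter (nbhs (almost_everywhere (@lebesgue_measure R))).
Proof. exact: ae_filter_ringOfSetsType. Qed.

Section Norms.
Context {R : realType} {V : normedModType R}.
Implicit Types (F : R -> V) (a b : R).

(** For polynomials the squared norm is again a real polynomial, whose
    integral is finite. *)
Lemma Lnorm_on2_poly a b F (G : {poly R}) : (forall t, `|F t| ^+ 2 = G.[t]) ->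
  Lnorm_on 2%:E `]a, b] F = (Num.sqrt (poly_int a b G))%:E.
Proof.
move=> FG; rewrite /Lnorm_on unlock.
have -> : (fun x => `|((fun t => `|F t|%:E) \_ `]a, b]) x| `^ 2)%E =
    (fun t => (G.[t])%:E) \_ `]a, b].
  apply/funext => t; rewrite /patch; case: ifPn => _.
    by rewrite -FG /= normr_id powR_mulrn.
  by rewrite abse0 poweR0r// pnatr_eq0.
rewrite -integral_mkcond -[X in (X `^ _)%E]fineK; last first.
  by apply: integrable_fin_num => //; exact: poly_integrable.
rewrite poweR_EFin powR12_sqrt// -/(poly_int a b G).
by apply: poly_int_ge0 => t; rewrite -FG sqr_ge0.
Qed.

Lemma lebesgue_measure_setT_gt0 : (0 < @lebesgue_measure R [set: R])%E.
Proof.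
apply: (@lt_le_trans _ _ (lebesgue_measure (`]0, 1] : set R))).
  by rewrite lebesgue_measure_itv/= lte01 sube0 lte01.
by apply: le_measure; rewrite ?inE.
Qed.

Lemma Lnorm_on_oo_le a b F (M : R) : 0 <= M ->
  {ae lebesgue_measure, forall t, t \in `]a, b] -> `|F t| <= M} ->
  (Lnorm_on +oo `]a, b] F <= M%:E)%E.
Proof.
move=> M_ge0 FM; rewrite /Lnorm_on unlock lebesgue_measure_setT_gt0.
apply/ess_supP; apply: filterS FM => t FM /=.
rewrite /patch; case: ifPn => [tab|_]; last by rewrite abse0 lee_fin.
rewrite /= lee_fin normr_id; apply: FM; exact: set_mem tab.
Qed.

Lemma Lnorm_on_oo_ge a b F (M : R) : Lnorm_on +oo `]a, b] F = M%:E ->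
  {ae lebesgue_measure, forall t, t \in `]a, b] -> `|F t| <= M}.
Proof.
rewrite /Lnorm_on unlock lebesgue_measure_setT_gt0 => FM.
have := ess_sup_ge (@lebesgue_measure R) (abse \o (fun t => `|F t|%:E) \_ `]a, b]).
rewrite FM; apply: filterS => t /= + tab.
by rewrite /patch mem_set//= lee_fin normr_id.
Qed.

End Norms.

(** * The scalar operator and the stability constant *)

Section ScalarInstance.
Context {R : realType} (a b : R) (r : nat) (ell : {poly R}).
Context (ab : a < b) (ellP : is_eval_poly a b r ell).
Implicit Types (f v psi : {poly R}) (lambda : R).

(* The real line as a space with the orthonormal basis 1. *)
Let phi1 (i : 'I_1) : R^o := 1.

Let comb1 (c : 'I_1 -> R) : comb phi1 c = c ord0.
Proof. by rewrite /comb big_ord1 /GRing.scale/= mulr1. Qed.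

Let span1 : [set: R^o] = lin_span phi1.
Proof.
apply/seteqP; split=> // x _; exists (fun=> x).
by rewrite -[RHS]/(comb phi1 (fun=> x)) comb1.
Qed.

Let poly_comb1 f : poly_comb phi1 (fun=> f) = horner f.
Proof. by apply/funext => t; rewrite /poly_comb comb1. Qed.

Let scalar_prod_comb (c d : 'I_1 -> R) :
  scalar_prod (comb phi1 c) (comb phi1 d) = \sum_(i < 1) c i * d i.
Proof. by rewrite !comb1 big_ord1. Qed.

Lemma scalar_poly_horner (u : R -> R^o) : scalar_poly r u ->
  exists2 p : {poly R}, (size p <= r.+1)%N & u = horner p.
Proof.
rewrite /scalar_poly span1 => /poly_space_spanP[p p_size ->].
by exists (p ord0) => //; apply/funext => t; rewrite /poly_comb comb1.
Qed.

Lemma scalar_liftingE : scalar_lifting a b r 1 = horner ell.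
Proof.
rewrite /scalar_lifting /scalar_poly span1 -[1]/((fun=> 1) (@ord0 0)) -comb1.
rewrite (lifting_comb scalar_prod_comb ab ellP) -poly_comb1.
by congr poly_comb; apply/funext => i; rewrite scale1r.
Qed.

Lemma scalar_parabolic_invE lambda f v : 0 < lambda -> (size v <= r.+1)%N ->
  poly_op a ell lambda v = f ->
  scalar_parabolic_inv a b r lambda (horner f) = horner v.
Proof.
move=> lambda_gt0 v_size vf.
rewrite /scalar_parabolic_inv /scalar_poly span1 -!poly_comb1.
apply: (parabolic_inv_poly_comb scalar_prod_comb ab ellP
  (lambda := fun=> lambda)) => // c.
by rewrite !comb1.
Qed.

Lemma errE lambda psi : 0 < lambda -> (size psi <= r.+1)%N ->
  poly_op a ell lambda psi = ell -> err a b r lambda = dg_err a lambda psi.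
Proof.
move=> lambda_gt0 psi_size psiE; apply/funext => t; rewrite /err /Defs.psi.
by rewrite scalar_liftingE (scalar_parabolic_invE _ psi_size psiE).
Qed.

(** The pointwise factor e(t) is Upsilon |err(t) / err(a)| + 1, which is at
    most the constant only for almost every t.  It is kept apart from f and v
    so that the exceptional null set does not depend on them. *)
Lemma C_L2_stability lambda : 0 < lambda -> exists e : R -> R, exists c : R,
  [/\ C_L2 a b r lambda = c%:E,
      {ae lebesgue_measure, forall t, t \in `]a, b] -> e t <= c} &
      forall f v, (size v <= r.+1)%N -> poly_op a ell lambda v = f ->
        forall t, t \in `]a, b] ->
        `|v.[t]| <= e t * (Num.sqrt (b - a) * Num.sqrt (poly_int a b (f * f)))].
Proof.
move=> lambda_gt0.
have [psi psi_size psiE] := poly_op_onto ab ellP lambda_gt0 ellP.1.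
set E := dg_err a lambda psi.
set U := Upsilon r ((b - a) * lambda).
have U_ge0 : 0 <= U by exact: sqrtr_ge0.
pose quot : R -> R^o := fun t => E t / E a.
have quot_cont : continuous (fun t => `|quot t| : R).
  move=> t; apply: (@continuous_comp _ _ _ quot (fun x : R => `|x|)).
    apply: continuousM; last exact: cst_continuous.
    apply/differentiable_continuous/derivable1_diffP.
    by case: (is_derive_dg_err t psiE).
  exact: norm_continuous.
have [tmax _ quot_le] := EVT_max (ltW ab) (continuous_subspaceT quot_cont).
(* The norm is finite because the quotient is continuous on [a, b]. *)
have [eps epsE] : exists eps, Lnorm_on +oo%E `]a, b] quot = eps%:E.
  exists (fine (Lnorm_on +oo%E `]a, b] quot)); rewrite fineK// ge0_fin_numE//.
    apply: le_lt_trans (ltry `|quot tmax|); apply: Lnorm_on_oo_le => //.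
    apply: aeW => t tab; apply: quot_le.
    by move: tab; rewrite !in_itv/= => /andP[/ltW -> ->].
  exact: Lnorm_ge0.
exists (fun t => U * `|quot t| + 1), (U * eps + 1); split.
- by rewrite /C_L2 (errE lambda_gt0 psi_size psiE) -/E -/U epsE.
- apply: filterS (Lnorm_on_oo_ge epsE) => t quot_t tab.
  by rewrite lerD2r ler_wpM2l// quot_t.
move=> f v v_size vE t; rewrite in_itv/= => /andP[/ltW at_ tb].
by apply: (poly_op_pointwise_le ab ellP lambda_gt0 psiE v_size vE); rewrite at_.
Qed.

End ScalarInstance.

(** * The discrete elliptic operator *)

Section DiscreteOperator.
Context {R : realType} {V : normedModType R} {n : nat} (phi : 'I_n -> V).
Context (ip : V -> V -> R) (A : {linear V -> (V -> R^o)}).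
Context (ip_comb : forall c d : 'I_n -> R,
  ip (comb phi c) (comb phi d) = \sum_(i < n) c i * d i).
Context (A_linear : forall u, linear (A u)).

(** Testing the defining identity with phi i gives the i-th coordinate. *)
Lemma discrete_opE u :
  discrete_op ip (lin_span phi) A u = comb phi (fun i => A u (phi i)).
Proof.
have A_comb (d : 'I_n -> R) : A u (comb phi d) = \sum_(i < n) d i * A u (phi i).
  pose Au : {linear V -> R^o} :=
    HB.pack (A u : V -> R^o) (GRing.isLinear.Build _ _ _ _ (A u) (A_linear u)).
  rewrite -[LHS]/(Au (comb phi d)) linear_sum.
  by apply: eq_bigr => i _; rewrite linearZ.
apply: xget_unique; first split; first by eexists.
  by move=> _ [d ->]; rewrite A_comb ip_comb; apply: eq_bigr => i _; rewrite mulrC.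
move=> _ [[c ->] cE]; congr comb; apply/funext => i.
have := cE (phi i); have [e [phiE e_i]] : exists e, phi i = comb phi e /\
    forall d : 'I_n -> R, \sum_(j < n) d j * e j = d i.
  exists (fun j => (i == j)%:R); split.
    rewrite /comb (bigD1 i)//= eqxx scale1r big1 ?addr0// => j.
    by rewrite eq_sym => /negPf ->; rewrite scale0r.
  move=> d; rewrite (bigD1 i)//= eqxx mulr1 big1 ?addr0// => j.
  by rewrite eq_sym => /negPf ->; rewrite mulr0.
by rewrite {1 2}phiE -/(comb phi c) ip_comb e_i; apply; exists e.
Qed.

(** Additivity of discrete_op is not immediate from its choice-based
    definition, so the eigenvalue equations are first turned into the values
    A (phi j) (phi i) of the form. *)
Lemma discrete_op_comb (lambda c : 'I_n -> R) :
  (forall i, discrete_op ip (lin_span phi) A (phi i) = lambda i *: phi i) ->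
  discrete_op ip (lin_span phi) A (comb phi c) =
    comb phi (fun i => lambda i * c i).
Proof.
move=> eigen; rewrite discrete_opE; congr comb; apply/funext => i.
have A_phi j : A (phi j) (phi i) = lambda j * (j == i)%:R.
  have : comb phi (fun l => A (phi j) (phi l)) =
      comb phi (fun l => lambda j * (j == l)%:R).
    rewrite -discrete_opE eigen /comb (bigD1 j)//= eqxx mulr1.
    rewrite big1 ?addr0// => l.
    by rewrite eq_sym => /negPf ->; rewrite mulr0 scale0r.
  by move=> /(comb_inj ip_comb)/(congr1 (@^~ i)).
have A_scale j : A (c j *: phi j) (phi i) = c j * (lambda j * (j == i)%:R).
  by rewrite -A_phi linearZ.
rewrite /comb linear_sum fct_sumE (bigD1 i)//= A_scale eqxx mulr1.
rewrite big1 ?addr0 => [|j /negPf ji]; first by rewrite mulrC.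
by rewrite A_scale ji !mulr0.
Qed.

End DiscreteOperator.

Theorem proposition4p3 (R : realType)
  (H X : completeNormedModType R)
  (ipH : {dot H for (@idfun R)}) (ipX : {dot X for (@idfun R)})
  (hipH : hilbert_product ipH) (hipX : hilbert_product ipX)
  (iota : {linear X -> H})
  (iota_inj : injective iota) (iota_cont : continuous iota)
  (iota_dense : dense (range iota))
  (A : {linear X -> (X -> R^o)})
  (A_dual : forall v, dual_space (A v))
  (A_sym : forall v w, A v w = A w v)
  (alpha beta : R) (alpha_gt0 : 0 < alpha) (beta_gt0 : 0 < beta)
  (A_coercive : forall v, alpha * `|v| ^+ 2 <= A v v)
  (A_bounded : forall v w, `|A v w| <= beta * `|v| * `|w|)
  (M : nat) (T : R) (t : nat -> R)
  (t_0 : t 0%N = 0) (t_M : t M = T)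
  (t_incr : forall j, (j < M)%N -> t j < t j.+1)
  (r : nat -> nat) (n : nat -> nat) (XX : nat -> set X)
  (XX_dim : forall j, (1 <= j <= M)%N -> subspace_of_dim (n j) (XX j))
  (m : nat) (hm : (1 <= m <= M)%N)
  (phi : 'I_(n m) -> X) (lambda : 'I_(n m) -> R)
  (w : R -> X) (a : 'I_(n m) -> R -> R^o) :
  let I := `]t m.-1, t m]%classic in
  let k := t m - t m.-1 in
  let P := poly_space (r m) (XX m) in
  let ip := fun u v : X => ipH (iota u) (iota v) in
  let Am := discrete_op ip (XX m) A in
  let Gamma_inv := parabolic_inv ip (t m.-1) (t m) P Am in
  let Gamma_scalar_inv := scalar_parabolic_inv (t m.-1) (t m) (r m) in
  basis_for (XX m) phi ->
  (forall i j, ip (phi i) (phi j) = (i == j)%:R) ->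
  (forall i, Am (phi i) = lambda i *: phi i) ->
  (forall i, 0 < lambda i) ->
  P w ->
  (forall i, scalar_poly (r m) (a i)) ->
  w = (fun s => \sum_(i < n m) a i s *: phi i) ->
  let C := \big[maxe/0%E]_(i < n m) C_L2 (t m.-1) (t m) (r m) (lambda i) in
  Gamma_inv w =
    (fun s => \sum_(i < n m) Gamma_scalar_inv (lambda i) (a i) s *: phi i) /\
  (Lnorm_on +oo I (iota \o Gamma_inv w) <=
     C * (Num.sqrt k)%:E * Lnorm_on 2%:E I (iota \o w))%E.
Proof.
move=> I k P ip Am Gamma_inv Gamma_scalar_inv [_ XXE] phi_on phi_eig lambda_gt0.
move=> _ a_poly wE C.
have ab : t m.-1 < t m.
  by have /andP[m_gt0] := hm; rewrite -{1 3}(prednK m_gt0); exact: t_incr.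
have ip_comb c d : ip (comb phi c) (comb phi d) = \sum_(i < n m) c i * d i.
  have ip_scale i j : ipH (iota (c i *: phi i)) (iota (d j *: phi j)) =
      c i * (d j * (i == j)%:R).
    by rewrite -phi_on /ip !linearZ/= linearZl_LR mulrCA.
  rewrite /ip /comb (linear_sum iota) linear_sumlz; apply: eq_bigr => i _.
  rewrite (linear_sum iota) linear_sumr (bigD1 i)//= ip_scale eqxx mulr1.
  rewrite big1 ?addr0// => j ji.
  by rewrite ip_scale eq_sym (negPf ji) !mulr0.
have Am_comb c : Am (comb phi c) = comb phi (fun i => lambda i * c i).
  rewrite /Am XXE; apply: discrete_op_comb => //.
    by move=> u; case: (A_dual u).
  by move=> i; rewrite -XXE; exact: phi_eig.
have [ell ellP] := eval_poly_exists (r m) ab.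
have /choice[f fP] : forall i, exists p : {poly R},
    (size p <= (r m).+1)%N /\ a i = horner p.
  move=> i.
  by have [p p_size pE] := scalar_poly_horner (a_poly i); exists p.
have /choice[v vP] : forall i, exists p : {poly R},
    (size p <= (r m).+1)%N /\ poly_op (t m.-1) ell (lambda i) p = f i.
  move=> i.
  by have [p p_size pE] := poly_op_onto ab ellP (lambda_gt0 i) (fP i).1; exists p.
have w_comb : w = poly_comb phi f.
  rewrite wE; apply/funext => s; apply: eq_bigr => i _.
  by rewrite (fP i).2.
have invE : Gamma_inv w = poly_comb phi v.
  rewrite /Gamma_inv /P w_comb XXE.
  by apply: (parabolic_inv_poly_comb ip_comb ab ellP Am_comb lambda_gt0) => i;
    case: (vP i).
rewrite invE; split.
  apply/funext => s; apply: eq_bigr => i _; have [v_size vE] := vP i.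
  rewrite /Gamma_scalar_inv (fP i).2.
  by rewrite (scalar_parabolic_invE ab ellP (lambda_gt0 i) v_size vE).
have norm_comb (c : 'I_(n m) -> R) : `|iota (comb phi c)| ^+ 2 = \sum_(i < n m) c i ^+ 2.
  by rewrite -hipH -/(ip _ _) ip_comb; apply: eq_bigr => i _; rewrite expr2.
pose J i := poly_int (t m.-1) (t m) (f i * f i).
have J_ge0 i : 0 <= J i by exact: poly_int_sqr_ge0.
have L2E : Lnorm_on 2%:E I (iota \o w) = (Num.sqrt (\sum_(i < n m) J i))%:E.
  rewrite (@Lnorm_on2_poly _ _ _ _ _ (\sum_(i < n m) f i * f i)).
    by rewrite /J; congr (Num.sqrt _)%:E; exact: linear_sum.
  move=> s; rewrite w_comb /= norm_comb horner_sum.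
  by apply: eq_bigr => i _; rewrite hornerM expr2.
have /choice[e /choice[c cP]] := fun i => C_L2_stability ab ellP (lambda_gt0 i).
pose Cr := \big[Num.max/0]_(i < n m) c i.
have CE : C = Cr%:E.
  rewrite /C /Cr -EFin_bigmax; apply: eq_bigr => i _.
  by case: (cP i).
have Cr_ge0 : 0 <= Cr by exact: bigmax_ge_id.
rewrite CE L2E -!EFinM; apply: Lnorm_on_oo_le.
  by rewrite mulr_ge0 ?sqrtr_ge0// mulr_ge0 ?sqrtr_ge0.
have : {ae lebesgue_measure, forall s i,
    s \in `]t m.-1, t m] -> e i s <= c i}.
  by apply: filter_forall => i; case: (cP i).
apply: filterS => s e_le sI /=.
have bound_ge0 : 0 <= Cr * Num.sqrt k by rewrite mulr_ge0// sqrtr_ge0.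
rewrite -(@ler_pXn2r _ 2)// ?nnegrE ?normr_ge0 ?mulr_ge0 ?sqrtr_ge0//.
rewrite norm_comb exprMn sqr_sqrtr ?sumr_ge0// mulr_sumr; apply: ler_sum => i _.
rewrite -real_normK ?num_real// -[J i]sqr_sqrtr// -exprMn.
rewrite ler_pXn2r// ?nnegrE ?normr_ge0 ?mulr_ge0 ?sqrtr_ge0//.
have [_ _ v_le] := cP i; have [v_size vE] := vP i.
apply: le_trans (v_le _ _ v_size vE s sI) _.
rewrite -mulrA ler_wpM2r ?mulr_ge0 ?sqrtr_ge0//.
by rewrite (le_trans (e_le i sI))// le_bigmax.
Qed.
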